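(* Let $p$ be an odd prime and let $G=(V,w)$ be a $p$-periodic weighted graph. Then the reduction modulo $p$ of the Laplacian characteristic polynomial $\psi_G(x)$ lies in $\mathbb{F}_p[x^p]$ and is divisible by $x^p$ in $\mathbb{F}_p[x^p]$.
   Context: A weighted graph is a pair $G=(V,w)$ where $V=\{v_1,\dots,v_n\}$ is a finite set and $w:V\times V\to \mathbb{Z}_{\ge 0}$ is a symmetric function. Its adjacency matrix is $A(G)=[w(v_i,v_j)]$. The degree matrix $D(G)$ is the diagonal $n\times n$ matrix with $i$-th diagonal entry $\deg(v_i)=\sum_{j=1}^n w(v_i,v_j)$, the Laplacian matrix is $L(G)=D(G)-A(G)$, and $\psi_G(x)=\det(xI_n-L(G))\in\mathbb{Z}[x]$. An automorphism of $G$ is a permutation $\sigma$ of $V$ with $w(\sigma(u),\sigma(v))=w(u,v)$ for all $u,v$. For an integer $p\ge 2$, $G$ is called $p$-periodic if there is an automorphism $h$ with $h^p=\mathrm{Id}$ and $h^i(v)\ne v$ for all $v\in V$ and all $1\le i\le p-1$. *)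

(* Defs.v *)
From HB Require Import structures.
From mathcomp Require Import all_boot all_order all_algebra all_fingroup.

Set Implicit Arguments.
Unset Strict Implicit.
Unset Printing Implicit Defensive.

Import GRing.Theory.
Local Open Scope ring_scope.

(* Loops are allowed: the value of the weight at (v, v) is unconstrained. *)
Record weighted_graph := WeightedGraph {
  vertex :> finType;
  weight : vertex -> vertex -> nat;
  weight_sym : forall u v, weight u v = weight v u
}.

(* The vertices are numbered by [enum_val : 'I_#|G| -> G]. *)
Definition adjacency (G : weighted_graph) : 'M[int]_#|G| :=
  \matrix_(i, j) (weight (enum_val i) (enum_val j))%:Z.

Definition degree (G : weighted_graph) (v : G) : nat :=
  (\sum_(u : G) weight v u)%N.

Definition degree_mx (G : weighted_graph) : 'M[int]_#|G| :=
  diag_mx (\row_i (degree (enum_val i))%:Z).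

Definition laplacian (G : weighted_graph) : 'M[int]_#|G| :=
  degree_mx G - adjacency G.

Definition laplacian_char_poly (G : weighted_graph) : {poly int} :=
  char_poly (laplacian G).

Definition automorphism (G : weighted_graph) (s : {perm G}) : Prop :=
  forall u v : G, weight (s u) (s v) = weight u v.

Definition periodic (p : nat) (G : weighted_graph) : Prop :=
  exists h : {perm G},
    [/\ automorphism h, (h ^+ p = 1)%g &
        forall (v : G) (i : nat), (1 <= i <= p.-1)%N -> (h ^+ i)%g v <> v].

Definition reduction_mod (p : nat) (f : {poly int}) : {poly 'F_p} :=
  map_poly (intr : int -> 'F_p) f.

(* Membership in the subring R[x^k] of R[x]. *)
Definition in_poly_Xn (R : nzRingType) (k : nat) (f : {poly R}) : Prop :=
  exists g : {poly R}, f = g \Po 'X^k.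

(* Divisibility inside R[x^k]: the cofactor has to lie in R[x^k] too. *)
Definition dvd_in_poly_Xn (R : nzRingType) (k : nat) (d f : {poly R}) : Prop :=
  exists2 q : {poly R}, in_poly_Xn k q & f = d * q.

(* Main.v *)
(** Since [h] commutes with [xI - L], each term of the Leibniz expansion of
    [det (xI - L)] is invariant under the conjugation of its permutation by [h].
    Modulo [p] the conjugacy orbits of length [p] cancel, and only permutations
    commuting with [h] remain. For these, the entries in the product are
    constant along the free [h]-orbits of indices, so the product is a [p]-th
    power, hence a polynomial in [x^p]. As the rows of [L] sum to zero, the
    constant term vanishes, which gives the factor [x^p]. *)
Require Import Defs.
From HB Require Import structures.
From mathcomp Require Import all_boot all_order all_algebra all_fingroup.
From mathcomp Require Import cyclic.

Set Implicit Arguments.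
Unset Strict Implicit.
Unset Printing Implicit Defensive.

Import GRing.Theory.
Local Open Scope ring_scope.

(** Orbits partition the index type and [F] is constant on each, so an orbit contributes an iterate
    of [op (F x)]. A general commutative [op] covers both the Leibniz sum and the products inside
    it. *)
Lemma big_orbit_closed (R : Type) (idx : R) (op : Monoid.com_law idx)
    (aT : finGroupType) (rT : finType) (to : {action aT &-> rT})
    (G : {group aT}) (F : rT -> R) (P : R -> Prop) :
    (forall x a, a \in G -> F (to x a) = F x) ->
    P idx -> (forall u v, P u -> P v -> P (op u v)) ->
    (forall x, P (iter #|orbit to G x| (op (F x)) idx)) ->
  P (\big[op/idx]_x F x).
Proof.
move=> F_inv P1 PM Porb.
have actsT : [acts G, on [set: rT] | to].
  by apply/actsP=> a _ x; rewrite !inE.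
have /and3P[/eqP covT trivT _] := orbit_partition actsT.
rewrite (eq_bigl [in cover [set orbit to G x | x in [set: rT]]]) => [|x]; last first.
  by rewrite covT inE.
rewrite big_trivIset //.
apply: big_ind => // _ /imsetP[x _ ->].
rewrite (eq_bigr (fun=> F x)) ?big_const // => _ /orbitP[a Ga <-].
exact: F_inv.
Qed.

Lemma cycle_invariant (aT : finGroupType) (rT : finType)
    (to : {action aT &-> rT}) (R : Type) (F : rT -> R) (a : aT) :
    (forall x, F (to x a) = F x) ->
  forall x b, b \in <[a]>%g -> F (to x b) = F x.
Proof.
move=> F_inv x _ /cycleP[k ->]; rewrite actX.
by elim: k => //= k IHk; rewrite F_inv.
Qed.

(** The orbit size divides the order of [a], hence the prime [p]. *)
Lemma prime_card_orbit (aT : finGroupType) (rT : finType)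
    (to : {action aT &-> rT}) (p : nat) (a : aT) (x : rT) :
    prime p -> (a ^+ p = 1)%g ->
  #|orbit to <[a]> x| = if to x a == x then 1%N else p.
Proof.
move=> p_pr ap1; case: eqP => [fix_x | nfix_x].
  apply/eqP/cards1P; exists x; apply/orbit1P.
  by rewrite afix_cycle; apply/afix1P.
have : (#|orbit to <[a]> x| %| p)%N.
  by rewrite (dvdn_trans (dvdn_orbit _ _ _)) // order_dvdn ap1.
case/primeP: p_pr => _ /[apply] /pred2P[] // /card_orbit1 orb_x.
by case: nfix_x; apply/set1P; rewrite -orb_x mem_orbit ?cycle_id.
Qed.

Section PolyXn.

Variables (R : comNzRingType) (k : nat).
Implicit Types f g : {poly R}.

Lemma in_poly_XnC (c : R) : in_poly_Xn k c%:P.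
Proof. by exists c%:P; rewrite comp_polyC. Qed.

Lemma in_poly_XnD f g : in_poly_Xn k f -> in_poly_Xn k g -> in_poly_Xn k (f + g).
Proof. by case=> f' -> [g' ->]; exists (f' + g'); rewrite rmorphD. Qed.

Lemma in_poly_XnM f g : in_poly_Xn k f -> in_poly_Xn k g -> in_poly_Xn k (f * g).
Proof. by case=> f' -> [g' ->]; exists (f' * g'); rewrite rmorphM. Qed.

(** If [f] is [g] evaluated at ['X^k], then [g] vanishes at 0 too. Writing [g = q * 'X] and
    substituting ['X^k] yields a cofactor in R[x^k]. *)
Lemma in_poly_Xn_dvd f : (0 < k)%N ->
  in_poly_Xn k f -> root f 0 -> dvd_in_poly_Xn k 'X^k f.
Proof.
move=> k_gt0 [g ->]; rewrite /root horner_comp hornerXn expr0n gtn_eqF //.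
case/factor_theorem=> q ->; exists (q \Po 'X^k); first by exists q.
by rewrite subr0 rmorphM /= comp_polyX mulrC.
Qed.

Lemma in_poly_Xn_pchar_exp f : k \in [pchar R] -> in_poly_Xn k (f ^+ k).
Proof.
move=> pcharR; have pcharP : k \in [pchar {poly R}] by rewrite pchar_poly.
elim/poly_ind: f => [|f c IHf].
  by rewrite expr0n gtn_eqF ?(prime_gt0 (pcharf_prime pcharR)) //; apply: in_poly_XnC.
(* Frobenius is additive: the [k]-th power of [f * 'X + c] is [f ^+ k * 'X^k + c ^+ k]. *)
rewrite -(pFrobenius_autE pcharP) rmorphD rmorphM /= !pFrobenius_autE -polyC_exp.
apply: in_poly_XnD (in_poly_XnC _); apply: in_poly_XnM IHf _.
by exists 'X; rewrite comp_polyX.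
Qed.

End PolyXn.

Section FreeSymmetry.

Variables (R : comNzRingType) (p n : nat) (g : 'S_n).
Hypotheses (pcharR : p \in [pchar R]) (gp1 : (g ^+ p = 1)%g).
Hypothesis g_free : forall i, g i != i.

Lemma det_in_poly_Xn (M : 'M[{poly R}]_n) :
  (forall i j, M (g i) (g j) = M i j) -> in_poly_Xn p (\det M).
Proof.
move=> M_inv; have p_pr := pcharf_prime pcharR.
apply: (big_orbit_closed (to := 'J%act) (G := <[g]>%G)).
- apply: cycle_invariant => s /=; rewrite odd_permJ; congr (_ * _).
  (* The conjugate of [s] sends [g i] to [g (s i)], so reindexing by [g] matches the factors. *)
  rewrite (reindex_inj (@perm_inj _ g)) /=.
  by apply: eq_bigr => i _; rewrite permJ M_inv.
- exact: in_poly_XnC 0.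
- exact: in_poly_XnD.
move=> s; rewrite (prime_card_orbit _ _ p_pr gp1) /=; case: eqP => [sg | _]; last first.
  (* An orbit of length [p] adds [p] equal terms, which is 0 in characteristic [p]. *)
  by rewrite iter_addr_0 mulrn_pchar ?pchar_poly //; apply: in_poly_XnC 0.
rewrite /= addr0; apply: in_poly_XnM.
  by rewrite -polyCN -polyC_exp; apply: in_poly_XnC.
apply: (big_orbit_closed (to := 'P%act) (G := <[g]>%G)).
(* Here [sg] says that [s] commutes with [g], so [M (g i) (s (g i))] equals [M i (s i)]. *)
- by apply: cycle_invariant => i /=; rewrite apermE -{1}sg permJ M_inv.
- exact: in_poly_XnC 1.
- exact: in_poly_XnM.
move=> i; rewrite (prime_card_orbit _ _ p_pr gp1) /= apermE (negbTE (g_free i)).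
rewrite iter_mulr_1; exact: in_poly_Xn_pchar_exp.
Qed.

Lemma char_poly_in_poly_Xn (A : 'M[R]_n) :
  (forall i j, A (g i) (g j) = A i j) -> in_poly_Xn p (char_poly A).
Proof.
move=> A_inv; apply: det_in_poly_Xn => i j.
by rewrite !mxE A_inv (inj_eq perm_inj).
Qed.

End FreeSymmetry.

Lemma char_poly_root0 (R : comNzRingType) (n : nat) (A : 'M[R]_n) :
  root (char_poly A) 0 = (\det A == 0).
Proof.
rewrite /root horner_coef0 char_poly_det -signr_odd mulr_sign.
by case: odd; rewrite ?oppr_eq0.
Qed.

Lemma laplacian_det (G : weighted_graph) : (0 < #|G|)%N -> \det (laplacian G) = 0.
Proof.
(* The all-ones row vector is a left null vector: column sums vanish because, by symmetry of the
   weights, they agree with row sums. *)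
move=> G_gt0; apply/eqP/det0P; exists (const_mx 1).
  by apply/eqP=> /rowP/(_ (Ordinal G_gt0)); rewrite !mxE.
apply/rowP=> j; rewrite !mxE.
under eq_bigr do rewrite !mxE mul1r.
rewrite sumrB (bigD1 j) //= eqxx mulr1n big1 => [|i /negbTE->]; last by rewrite mulr0n.
rewrite addr0 /degree -(big_enum_val (A := G) (fun u => (weight u (enum_val j))%:Z)) /=.
rewrite -natz natr_sum; apply/eqP; rewrite subr_eq0; apply/eqP.
by apply: eq_bigr => u _; rewrite natz weight_sym.
Qed.

Lemma degree_automorphism (G : weighted_graph) (s : {perm G}) (v : G) :
  automorphism s -> degree (s v) = degree v.
Proof.
move=> s_aut; rewrite /degree (reindex_inj (@perm_inj _ s)).
by apply: eq_bigr => u _; rewrite s_aut.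
Qed.

Section IndexPerm.

Variables (T : finType) (s : {perm T}).

(** Carries a vertex permutation over to matrix indices. *)
Definition index_perm : {perm 'I_#|T|} :=
  perm (inj_comp enum_rank_inj (inj_comp (@perm_inj _ s) enum_val_inj)).

Lemma enum_val_index_perm i : enum_val (index_perm i) = s (enum_val i).
Proof. by rewrite permE /= enum_rankK. Qed.

Lemma enum_val_index_permX k i :
  enum_val ((index_perm ^+ k)%g i) = (s ^+ k)%g (enum_val i).
Proof.
by rewrite !permX; elim: k => //= k <-; rewrite enum_val_index_perm.
Qed.

End IndexPerm.

Lemma laplacian_index_perm (G : weighted_graph) (s : {perm G}) i j :
    automorphism s ->
  laplacian G (index_perm s i) (index_perm s j) = laplacian G i j.
Proof.
move=> s_aut; rewrite !mxE !enum_val_index_perm s_aut degree_automorphism //.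
by rewrite (inj_eq perm_inj).
Qed.

Theorem theorem1p3 (p : nat) (G : weighted_graph)
    (p_prime : prime p) (p_odd : odd p)
    (G_nonempty : (0 < #|G|)%N) (G_periodic : periodic p G) :
  in_poly_Xn p (reduction_mod p (laplacian_char_poly G)) /\
  dvd_in_poly_Xn p 'X^p (reduction_mod p (laplacian_char_poly G)).
Proof.
have inXp : in_poly_Xn p (reduction_mod p (laplacian_char_poly G)).
  case: G_periodic => h [h_aut hp1 h_free].
  rewrite /reduction_mod map_char_poly.
  apply: (char_poly_in_poly_Xn (g := index_perm h)).
  - exact: pchar_Fp.
  - apply/permP=> i; apply: enum_val_inj.
    by rewrite enum_val_index_permX hp1 !perm1.
  - move=> i; rewrite -(inj_eq enum_val_inj) enum_val_index_perm.
    (* Exponent 1 lies in the range of the freeness condition since [p > 1]. *)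
    by apply/eqP; apply: (h_free _ 1%N); rewrite /= -subn1 ltn_subRL prime_gt1.
  by move=> i j; rewrite mxE [RHS]mxE laplacian_index_perm.
split=> //; apply: in_poly_Xn_dvd; rewrite ?prime_gt0 //.
(* Viewing 0 as the image of the integer 0 reduces the claim to a root over the integers. *)
rewrite /reduction_mod -(rmorph0 (intr : int -> 'F_p)) rmorph_root //.
by rewrite char_poly_root0 laplacian_det.
Qed.
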